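(* Let $b\ge 2$ be an integer. If $p=m\otimes_b n$, then $p$ can also be written as $p=m'\otimes_b n'$, where $m'$ and $n'$ use only digits (in base $b$) that are digits of $p$.
   Context: Nonnegative integers are written in base $b$: $n=n_{k-1}\ldots n_1n_0|_b$ denotes $\sum_i n_ib^i$ with digits $n_i\in\{0,\ldots,b-1\}$. The dismal product of $m=m_{k-1}\ldots m_0|_b$ and $n=n_{l-1}\ldots n_0|_b$ is the number $m\otimes_b n$ whose $i$-th base $b$ digit, $0\le i\le k+l-2$, is $\max\{\min\{m_j,n_{i-j}\}:0\le j\le k-1,\ 0\le i-j\le l-1\}$ (no carries). *)

(* Defs.v *)
From mathcomp Require Import all_boot.
Set Implicit Arguments.
Unset Strict Implicit.
Unset Printing Implicit Defensive.

Definition digit (b n i : nat) : nat := (n %/ b ^ i) %% b.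

(* Length of the base b expansion without leading zeros; as trunc_log b 0 = 0,
   the number 0 has the single digit 0. *)
Definition ndigits (b n : nat) : nat := (trunc_log b n).+1.

(* Least significant digit first. *)
Definition digits (b n : nat) : seq nat := mkseq (digit b n) (ndigits b n).

(* The empty maximum is 0, but the range is nonempty whenever
   i <= ndigits b m + ndigits b n - 2. *)
Definition dismal_digit (b m n i : nat) : nat :=
  \max_(j < ndigits b m | (j <= i) && (i - j < ndigits b n))
    minn (digit b m j) (digit b n (i - j)).

Definition dismal_mul (b m n : nat) : nat :=
  \sum_(i < (ndigits b m + ndigits b n).-1) dismal_digit b m n i * b ^ i.

(* Main.v *)
Require Import Defs.
From mathcomp Require Import all_boot.
From mathcomp Require Import zify.

(** Dismal arithmetic only uses the lattice operations [minn] and [maxn], so a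
    nondecreasing map [f] applied to every digit of [m] and of [n] applies [f]
    to every digit of their product, as long as the leading digits do not
    become zero, so that no length changes ([dismal_digit_map]). Choose for [f]
    a nondecreasing retraction of [nat] onto the set of digits of [p]
    ([monotone_retract]): every digit of [p] is fixed, so the product is still
    [p], while the new factors only have digits of [p].

    Lengths survive because, for nonzero [m] and [n], the leading digit of [p]
    is the minimum of the two leading digits ([dismal_digit_lead]): it is
    positive and fixed by [f], and by monotonicity it is a lower bound of the
    images of both leading digits. If a factor is [0] then [p = 0], and
    [0 * 0 = 0] is already of the required form. *)

Set Implicit Arguments.
Unset Strict Implicit.
Unset Printing Implicit Defensive.

(** The retraction rounds down to an element of [D], after raising the
    arguments below all of [D] to its least element. *)
Lemma monotone_retract (D : seq nat) (x0 : nat) : x0 \in D ->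
  exists f : nat -> nat,
    [/\ {homo f : x y / x <= y}, forall x, f x \in D & {in D, f =1 id}].
Proof.
move=> Dx0; have exD : exists x, x \in D by exists x0.
case: (ex_minnP exD) => d Dd d_min.
pose P x := [pred e | (e \in D) && (e <= maxn x d)].
have exP x : exists e, P x e by exists d; rewrite /= Dd leq_maxr.
have ubP x e : P x e -> e <= maxn x d by case/andP.
exists (fun x => ex_maxn (exP x) (ubP x)); split.
- move=> x y le_xy.
  case: (ex_maxnP (exP x) (ubP x)) => u /andP[Du le_u] _.
  case: (ex_maxnP (exP y) (ubP y)) => v _; apply.
  by rewrite /= Du; lia.
- by move=> x; case: ex_maxnP => u /andP[].
- move=> x Dx; case: ex_maxnP => u /andP[_ le_u] /(_ x) u_max.
  have := d_min x Dx; have : x <= u by apply: u_max; rewrite /= Dx leq_maxl.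
  by rewrite /=; lia.
Qed.

Definition of_digits (b k : nat) (g : nat -> nat) : nat :=
  \sum_(i < k) g i * b ^ i.

Lemma dismal_mulE b m n :
  dismal_mul b m n =
  of_digits b (ndigits b m + ndigits b n).-1 (dismal_digit b m n).
Proof. by []. Qed.

Lemma of_digits_recl b k g :
  of_digits b k.+1 g = of_digits b k (fun i => g i.+1) * b + g 0.
Proof.
rewrite /of_digits big_ord_recl expn0 muln1 addnC big_distrl /=.
by congr (_ + _); apply: eq_bigr => i _; rewrite /bump add1n expnSr mulnA.
Qed.

Lemma eq_of_digits b k g h :
  (forall i, i < k -> g i = h i) -> of_digits b k g = of_digits b k h.
Proof. by move=> gh; apply: eq_bigr => i _; rewrite gh. Qed.

Lemma of_digits_lt b k g :
  (forall i, i < k -> g i < b) -> of_digits b k g < b ^ k.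
Proof.
elim: k => [|k IHk] gb; first by rewrite /of_digits big_ord0.
have {}IHk : of_digits b k g < b ^ k by apply: IHk => i /ltnW; apply: gb.
rewrite /of_digits big_ord_recr /= -/(of_digits b k g) expnS.
apply: (@leq_trans ((g k).+1 * b ^ k)); last by rewrite leq_mul2r gb ?orbT.
by rewrite mulSn ltn_add2r.
Qed.

Lemma digitS b n i : digit b n i.+1 = digit b (n %/ b) i.
Proof. by rewrite /digit expnS divnMA. Qed.

Lemma digit_of_digits b k g i :
  (forall j, j < k -> g j < b) -> i < k -> digit b (of_digits b k g) i = g i.
Proof.
elim: k g i => // k IHk g i gb lt_ik; have g0b := gb 0 isT.
have b_gt0 : 0 < b by apply: leq_ltn_trans g0b.
rewrite of_digits_recl; case: i lt_ik => [|i] lt_ik.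
  by rewrite /digit expn0 divn1 modnMDl modn_small.
by rewrite digitS divnMDl // divn_small // addn0 IHk // => j lt_jk; exact: (gb j.+1).
Qed.

Lemma ndigits_of_digits b k g :
  1 < b -> (forall i, i < k.+1 -> g i < b) -> 0 < g k ->
  ndigits b (of_digits b k.+1 g) = k.+1.
Proof.
move=> b_gt1 gb gk_gt0; congr _.+1; apply: trunc_log_eq => //.
rewrite of_digits_lt // andbT /of_digits big_ord_recr /=.
by apply: leq_trans (leq_addl _ _); rewrite leq_pmull.
Qed.

Lemma digit_lt b n i : 0 < b -> digit b n i < b.
Proof. by move=> b_gt0; rewrite ltn_mod. Qed.

Lemma digit_lead_gt0 b n :
  1 < b -> 0 < n -> 0 < digit b n (ndigits b n).-1.
Proof.
move=> b_gt1 n_gt0; have bt_gt0 : 0 < b ^ trunc_log b n by rewrite expn_gt0; lia.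
rewrite /digit /= modn_small; first by rewrite divn_gt0 ?trunc_logP.
by rewrite ltn_divLR // -expnS trunc_log_ltn.
Qed.

Lemma dismal_digit_lt b m n i : 0 < b -> dismal_digit b m n i < b.
Proof.
move=> b_gt0; suff: dismal_digit b m n i <= b.-1 by lia.
apply/bigmax_leqP => j _; rewrite geq_min.
by have := digit_lt m j b_gt0; lia.
Qed.

(** Only the two leading digits contribute to the top position. *)
Lemma dismal_digit_lead b m n :
  dismal_digit b m n (ndigits b m + ndigits b n).-2 =
  minn (digit b m (ndigits b m).-1) (digit b n (ndigits b n).-1).
Proof.
rewrite /dismal_digit; set s := trunc_log b m; set t := trunc_log b n.
rewrite /ndigits -/s -/t addSn addnS /=.
apply/eqP; rewrite eqn_leq; apply/andP; split.
  apply/bigmax_leqP => j /andP[le_j lt_t].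
  have -> : j = s :> nat by have := ltn_ord j; lia.
  by rewrite addKn.
have -> : digit b n t = digit b n (s + t - s) by rewrite addKn.
apply: (leq_bigmax_cond (ord_max : 'I_s.+1)).
by rewrite /= leq_addr addKn ltnS leqnn.
Qed.

Lemma dismal_mul0n b n : dismal_mul b 0 n = 0.
Proof.
rewrite /dismal_mul big1 // => i _; rewrite [dismal_digit _ _ _ _]big1 // => j _.
by rewrite /digit div0n mod0n min0n.
Qed.

Lemma dismal_muln0 b n : dismal_mul b n 0 = 0.
Proof.
rewrite /dismal_mul big1 // => i _; rewrite [dismal_digit _ _ _ _]big1 // => j _.
by rewrite /digit div0n mod0n minn0.
Qed.

(** The bound on [i] makes the range of the maximum nonempty: the empty maximum
    is [0], which [f] may move. *)
Lemma dismal_digit_map b (f : nat -> nat) m n m' n' i :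
  {homo f : x y / x <= y} ->
  ndigits b m' = ndigits b m -> ndigits b n' = ndigits b n ->
  (forall j, j < ndigits b m -> digit b m' j = f (digit b m j)) ->
  (forall j, j < ndigits b n -> digit b n' j = f (digit b n j)) ->
  i < (ndigits b m + ndigits b n).-1 ->
  dismal_digit b m' n' i = f (dismal_digit b m n i).
Proof.
move=> f_homo eq_m eq_n fm fn lt_i.
have f_min x y : minn (f x) (f y) = f (minn x y).
  by case: (leqP x y) => [|/ltnW] /f_homo; [move/minn_idPl | move/minn_idPr].
rewrite /dismal_digit eq_m eq_n.
pose P (j : 'I_(ndigits b m)) := (j <= i) && (i - j < ndigits b n).
pose F (j : 'I_(ndigits b m)) := minn (digit b m j) (digit b n (i - j)).
rewrite -/(\max_(j | P j) F j).
rewrite (eq_bigr (fun j => f (F j))); last first.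
  by move=> j /andP[_ lt_n]; rewrite fm // fn // f_min.
have [j0 Pj0] : exists j0, P j0.
  have lt_j0 : minn i (trunc_log b m) < ndigits b m by rewrite ltnS geq_minr.
  exists (Ordinal lt_j0); rewrite /P /= geq_minl /=.
  by move: lt_i; rewrite /ndigits; lia.
apply/eqP; rewrite eqn_leq; apply/andP; split.
  by apply/bigmax_leqP => j Pj; apply/f_homo/leq_bigmax_cond.
(* The maximum on the right is attained, at an index of the left range. *)
rewrite (bigmax_eq_arg _ Pj0); case: arg_maxnP => // j Pj _.
exact: (@leq_bigmax_cond _ P (fun j => f (F j))).
Qed.

Theorem corollary4 (b : nat) (hb : 2 <= b) (p m n : nat)
    (hp : p = dismal_mul b m n) :
  exists m' n' : nat,
    [/\ p = dismal_mul b m' n',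
        {subset digits b m' <= digits b p} &
        {subset digits b n' <= digits b p}].
Proof.
have b_gt0 : 0 < b := ltnW hb.
have [p0|p_gt0] := posnP p.
  by exists 0, 0; rewrite p0 dismal_mul0n; split.
have m_gt0 : 0 < m.
  by case: (posnP m) p_gt0 => // m0; rewrite hp m0 dismal_mul0n.
have n_gt0 : 0 < n.
  by case: (posnP n) p_gt0 => // n0; rewrite hp n0 dismal_muln0.
set D := digits b p.
pose q := dismal_digit b m n; pose t := (ndigits b m + ndigits b n).-2.
have t1E : t.+1 = (ndigits b m + ndigits b n).-1 by rewrite /t /ndigits; lia.
have pE : p = of_digits b t.+1 q by rewrite hp dismal_mulE t1E.
have q_lt i : i < t.+1 -> q i < b by move=> _; apply: dismal_digit_lt.
have qtE : q t = minn _ _ := dismal_digit_lead b m n.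
have qt_gt0 : 0 < q t by rewrite qtE leq_min !digit_lead_gt0.
have qD i : i < t.+1 -> q i \in D.
  move=> lt_i; apply/mapP; exists i; last by rewrite pE digit_of_digits.
  by rewrite mem_iota pE ndigits_of_digits.
have D_lt x : x \in D -> x < b by case/mapP => i _ ->; apply: digit_lt.
have [f [f_homo fD f_id]] := monotone_retract (qD t (ltnSn t)).
pose lift x := of_digits b (ndigits b x) (fun i => f (digit b x i)).
have f_lt x i : i < ndigits b x -> f (digit b x i) < b by move=> _; apply: D_lt.
have digit_lift x i : i < ndigits b x -> digit b (lift x) i = f (digit b x i).
  by move=> lt_i; rewrite digit_of_digits //; apply: f_lt.
have ndigits_lift x :
    q t <= digit b x (ndigits b x).-1 -> ndigits b (lift x) = ndigits b x.
  move=> le_qt; apply: ndigits_of_digits => //; first exact: f_lt.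
  by apply: leq_trans qt_gt0 _; rewrite -(f_id (q t)) ?qD //; apply: f_homo.
have lenm : ndigits b (lift m) = ndigits b m.
  by apply: ndigits_lift; rewrite qtE geq_minl.
have lenn : ndigits b (lift n) = ndigits b n.
  by apply: ndigits_lift; rewrite qtE geq_minr.
have sub_lift x :
    ndigits b (lift x) = ndigits b x -> {subset digits b (lift x) <= D}.
  move=> lenx y /mapP[i]; rewrite mem_iota lenx /= => lt_i ->.
  by rewrite digit_lift.
exists (lift m), (lift n); split; [|exact: sub_lift..].
rewrite dismal_mulE lenm lenn -t1E pE; apply: eq_of_digits => i lt_i.
rewrite (@dismal_digit_map b f m n) //; last by rewrite -t1E.
- by rewrite f_id ?qD.
- by move=> j; apply: digit_lift.
- by move=> j; apply: digit_lift.
Qed.
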